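(* Let $G$ be a multigraph with maximum edge multiplicity $\mu(G)=\mu$, such that $\Delta(G)$ cannot be expressed in the form $2p\mu-q$ with integers $q\ge 0$ and $p>\lfloor (q+1)/2\rfloor$. Then $\chi'(G)\le \Delta(G)+\mu(G)-1$.
   Context: Multigraphs are finite, without loops, and may have parallel edges. $\Delta(G)$ is the maximum degree of $G$, $\mu(G)$ is the maximum number of edges joining a pair of vertices, and $\chi'(G)$ is the minimum number of colors needed to color the edges of $G$ so that no two adjacent edges receive the same color. *)

(* Defs.v *)
From HB Require Import structures.
From mathcomp Require Import all_boot all_order all_algebra.

Set Implicit Arguments.
Unset Strict Implicit.
Unset Printing Implicit Defensive.

(* Edges are objects in their own right, so distinct edges may have the same
   ends; the absence of loops is the condition that an edge has two ends. *)
Record multigraph := Multigraph {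
  vertex : finType;
  edge : finType;
  ends : edge -> {set vertex};
  card_ends : forall e, #|ends e| = 2
}.

Section MultigraphInvariants.
Variable G : multigraph.

Definition degree (v : vertex G) : nat := #|[set e : edge G | v \in ends e]|.

Definition max_degree : nat := \max_(v : vertex G) degree v.

Definition multiplicity (x y : vertex G) : nat :=
  #|[set e : edge G | ends e == [set x; y]]|.

Definition max_multiplicity : nat :=
  \max_(xy : vertex G * vertex G | xy.1 != xy.2) multiplicity xy.1 xy.2.

Definition adjacent (e f : edge G) : bool :=
  (e != f) && (ends e :&: ends f != set0).

Definition proper_edge_coloring k (c : {ffun edge G -> 'I_k}) : bool :=
  [forall e, forall f, adjacent e f ==> (c e != c f)].

Definition edge_colorable k : bool :=
  [exists c : {ffun edge G -> 'I_k}, proper_edge_coloring c].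

Lemma exists_edge_colorable : exists k, edge_colorable k.
Proof.
exists #|edge G|; apply/existsP; exists [ffun e => enum_rank e].
apply/forallP=> e; apply/forallP=> f; apply/implyP=> /andP[neq_ef _].
by rewrite !ffunE (inj_eq enum_rank_inj).
Qed.

Definition chromatic_index : nat := ex_minn exists_edge_colorable.

End MultigraphInvariants.

(* Main.v *)
(** Let [d = mu - 1], and suppose that some set of coloured edges [F] cannot be
    extended by an edge [e = xy] with [k = Delta + d] colours.  Every vertex
    misses at least [d] colours, so for [d >= 1] Tashkinov's theorem applies:
    the vertices of a tree grown from [e], each new edge having a colour
    missing at an earlier vertex, miss pairwise disjoint sets of colours.

    With [2r + 1] vertices this gives [(2r + 1) d + 2 <= k], that is
    [r d < Delta / 2], and as [Delta] has not the excluded form (with [p = r])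
    it follows that [2 r mu < Delta] and [r <= d].  The tree can then be
    enlarged by two vertices for ever: one follows an edge leaving the tree in
    a missing colour, and from there the edge in a fixed colour missing at [x],
    which matches all other vertices of the tree.  This spends one new colour
    per step, so every vertex keeps a missing colour that the tree does not
    use.  If no edge leaves the tree in a missing colour, then counting the
    edges inside the tree ([2 r mu < Delta]) yields a colour with two edges
    leaving it, and Kempe changes with the unused colours make this colour
    missing at a vertex of the tree. *)

Require Import Defs.
From mathcomp Require Import all_boot all_order all_algebra.
From mathcomp Require Import all_fingroup zify.

Set Implicit Arguments.
Unset Strict Implicit.
Unset Printing Implicit Defensive.

(** * Kempe changes *)

Lemma ends_other (G : multigraph) (f : edge G) (v : vertex G) :
  v \in ends f -> exists2 w, w != v & ends f = [set v; w].
Proof.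
move=> vf; have /eqP/cards2P[p [q [neq_pq ef]]] := card_ends f.
move: vf; rewrite {1}ef !inE => /orP[]/eqP->; first by exists q; rewrite 1?eq_sym.
by exists p; rewrite // ef setUC.
Qed.

Lemma ends_neq (G : multigraph) (f : edge G) (u v : vertex G) :
  ends f = [set u; v] -> u != v.
Proof. by move=> ef; have := card_ends f; rewrite ef cards2; case: eqP. Qed.

Lemma set2_inj (T : finType) (u v w : T) : [set u; v] = [set u; w] -> v = w.
Proof.
move=> eq_vw; have := set22 u v; rewrite eq_vw !inE => /orP[]/eqP // eq_vu.
by have := set22 u w; rewrite -eq_vw eq_vu !inE => /orP[]/eqP.
Qed.

(** Cuts a path at its last vertex in [A], so as to isolate the final piece of a chain outside a
    tree. *)
Lemma path_exit (T : eqType) (r : rel T) (A : pred T) u p :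
    path r u p -> uniq (u :: p) -> A u ->
  exists v q, [/\ A v, path r v q, uniq (v :: q), all (predC A) q
                & last v q = last u p].
Proof.
move=> r_p Up Au.
suff [v [q [? ? ? ? [? _]]]] : exists v q,
    [/\ A v, path r v q, uniq (v :: q), all (predC A) q
      & last v q = last u p /\ {subset v :: q <= u :: p}].
  by exists v, q.
elim/last_ind: p => [|p w IHp] in r_p Up *.
  by exists u, [::]; split=> //; split.
move: r_p Up; rewrite rcons_path -rcons_cons rcons_uniq last_rcons.
move=> /andP[r_p r_w] /andP[w_p Up].
have [Aw|nAw] := boolP (A w).
  by exists w, [::]; split=> //; split=> // t; rewrite mem_rcons !inE => ->.
have [v [q [Av r_q Uq nAq [last_q sub_q]]]] := IHp r_p Up.
exists v, (rcons q w); split=> //.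
- by rewrite rcons_path r_q last_q.
- by rewrite -rcons_cons rcons_uniq Uq andbT; apply: contra w_p => /sub_q.
- by rewrite all_rcons /= nAw.
- rewrite last_rcons; split=> // t; rewrite -rcons_cons !mem_rcons inE.
  by rewrite [_ \in w :: _]inE => /orP[->|/sub_q->] //; rewrite orbT.
Qed.

(** * Components of graphs of maximum degree two *)

Section DegreeTwo.
Variables (T : finType) (r : rel T).
Hypothesis r_sym : symmetric r.
Hypothesis r_deg2 : forall u v w t,
  r u v -> r u w -> r u t -> [|| v == w, v == t | w == t].

Definition pendant u := forall v w, r u v -> r u w -> v = w.

(** Inner vertices of the path have both neighbours on it and its ends have only one, so no edge
    leaves the path. *)
Lemma pendant_path u p v :
    path r u p -> uniq (u :: p) -> last u p = v -> u != v ->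
    pendant u -> pendant v ->
  connect r u =i u :: p.
Proof.
move=> r_p Up last_p neq_uv pu pv t; apply/idP/idP; last first.
  move=> t_p; have [/eqP->|] := boolP (t == u); first exact: connect0.
  move: t_p; rewrite inE => /orP[/eqP->|t_p]; first by rewrite eqxx.
  case/path.splitP: t_p r_p => p1 p2; rewrite cat_path => /andP[r_p1 _] _.
  by apply/connectP; exists (rcons p1 t); rewrite ?last_rcons.
have closed_p s w : s \in u :: p -> r s w -> w \in u :: p.
  rewrite inE => /orP[/eqP->|s_p] r_sw.
    case: p => [|q p'] in r_p last_p Up *; first by rewrite -last_p eqxx in neq_uv.
    by move: r_p => /= /andP[r_uq _]; rewrite (pu _ _ r_sw r_uq) !inE eqxx orbT.
  case/splitPr: s_p r_p last_p Up => p1 p2.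
  rewrite cat_path last_cat -cat_cons => /andP[_ /=/andP[r_s r_p2]] /= last_p Up.
  have last_p1 := mem_last u p1; rewrite r_sym in r_s.
  case: p2 => [|q p2] in r_p2 last_p Up *.
    rewrite /= in last_p; rewrite -last_p in pv.
    suff: last u p1 \in (u :: p1) ++ [:: s] by rewrite (pv _ _ r_sw r_s).
    by rewrite mem_cat last_p1.
  move: r_p2 => /= /andP[r_sq _].
  have q_p1 : q \notin u :: p1.
    have : uniq ((u :: p1) ++ [:: s, q & p2]) by [].
    rewrite cat_uniq -all_predC => /and3P[_ /allP/(_ q)+ _].
    by apply; rewrite !inE eqxx orbT.
  have in_p i : (i \in u :: p1 ++ [:: s, q & p2]) =
      (i \in u :: p1) || (i \in [:: s, q & p2]) by rewrite -mem_cat.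
  rewrite in_p; case/or3P: (r_deg2 r_sw r_s r_sq) => /eqP eq_w.
  - by rewrite eq_w last_p1.
  - by rewrite eq_w !inE eqxx !orbT.
  - by rewrite -eq_w last_p1 in q_p1.
have sub_p q s : s \in u :: p -> path r s q -> last s q \in u :: p.
  elim: q s => //= w q IHq s s_p /andP[r_sw]; apply: IHq.
  exact: closed_p s_p r_sw.
by move=> /connectP[q r_q ->]; apply: sub_p; rewrite ?mem_head.
Qed.

(** The path from [u] to [v] is the whole component, and a third pendant vertex inside it would have
    two distinct neighbours. *)
Lemma pendant_connect u v w :
    pendant u -> pendant v -> pendant w ->
    u != v -> w != u -> w != v -> connect r u v ->
  ~~ connect r u w.
Proof.
move=> pu pv pw neq_uv neq_wu neq_wv /connectP[p0 r_p0 v_p0].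
move: neq_uv neq_wv pv; rewrite {}v_p0.
case/shortenP: r_p0 => p r_p Up _ neq_uv neq_wv pv.
have := pendant_path r_p Up erefl neq_uv pu pv w.
rewrite [_ \in connect _ _]inE => ->; rewrite inE (negPf neq_wu) /=.
apply/negP=> w_p; case/splitPr: w_p r_p Up neq_wv => p1 [|q p2].
  by rewrite last_cat /= eqxx.
rewrite cat_path -cat_cons cat_uniq => /and4P[_ r_w r_q _].
rewrite -all_predC => /and3P[_ /allP/(_ q) + _].
rewrite !inE eqxx orbT => /(_ isT).
rewrite r_sym in r_w; rewrite -(pw _ _ r_w r_q) => /negP[].
by have := mem_last u p1; rewrite inE.
Qed.

End DegreeTwo.

(** * Partial colourings, missing colours and two-coloured chains *)

Section PartialColorings.
Variables (G : multigraph) (k : nat) (F : {set edge G}).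
Local Notation V := (vertex G).
Local Notation E := (edge G).
Implicit Types (c : E -> 'I_k) (a b d : 'I_k) (W : {set V}).

Definition proper_on (A : {set E}) c := forall f g v,
  f \in A -> g \in A -> v \in ends f -> v \in ends g -> c f = c g -> f = g.

Definition miss c v : {set 'I_k} :=
  (* locked, lest [inE] unfold it *)
  locked [set a | [forall f in F, (v \in ends f) ==> (c f != a)]].

Lemma missP c v a :
  reflect (forall f, f \in F -> v \in ends f -> c f <> a) (a \in miss c v).
Proof.
rewrite /miss -lock inE; apply: (iffP forall_inP) => [H f fF vf | H f fF].
  by apply/eqP; apply: (implyP (H f fF)).
by apply/implyP=> vf; apply/eqP/H.
Qed.

Lemma missPn c v a :
  reflect (exists f, [/\ f \in F, v \in ends f & c f = a]) (a \notin miss c v).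
Proof.
apply: (iffP idP) => [|[f [fF vf cf]]]; last first.
  by apply/negP=> /missP/(_ f fF vf).
rewrite /miss -lock inE negb_forall_in => /exists_inP[f fF].
by rewrite negb_imply negbK => /andP[vf /eqP cf]; exists f.
Qed.

(** [W] may be any union of components of the two-coloured graph, not only one chain: a later change
    is made on the complement of a tree. *)
Definition kclosed c a b W := forall f u v,
  f \in F -> (c f == a) || (c f == b) -> u \in ends f -> v \in ends f ->
  u \in W -> v \in W.

Definition kempe c a b W : E -> 'I_k :=
  fun f => if ends f :&: W == set0 then c f else tperm a b (c f).

Definition bicolored c a b : rel V := fun u v =>
  [exists f in F, ((c f == a) || (c f == b)) && (ends f == [set u; v])].

Definition kchain c a b v : {set V} := [set w | connect (bicolored c a b) v w].

Lemma bicoloredP c a b u v :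
  reflect (exists f, [/\ f \in F, (c f == a) || (c f == b)
                       & ends f = [set u; v]]) (bicolored c a b u v).
Proof.
apply: (iffP exists_inP) => [[f fF /andP[cf /eqP ef]]|[f [fF cf ef]]].
  by exists f.
by exists f; rewrite // cf ef eqxx.
Qed.

Lemma bicolored_sym c a b : symmetric (bicolored c a b).
Proof.
by move=> u v; apply/bicoloredP/bicoloredP => -[f]; rewrite setUC; exists f.
Qed.

Lemma kchain_closed c a b v : kclosed c a b (kchain c a b v).
Proof.
move=> f s t fF cf sf tf; rewrite !inE => vs.
have [<-//|neq_st] := eqVneq s t.
apply: connect_trans vs (connect1 _); apply/bicoloredP; exists f.
split=> //; have [w neq_ws ef] := ends_other sf.
by move: tf; rewrite ef !inE eq_sym (negPf neq_st) => /eqP->.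
Qed.

Lemma mem_kchain c a b v : v \in kchain c a b v.
Proof. by rewrite inE connect0. Qed.

Lemma kempeE c a b W f v :
    kclosed c a b W -> f \in F -> v \in ends f ->
  kempe c a b W f = if v \in W then tperm a b (c f) else c f.
Proof.
move=> clW fF vf; rewrite /kempe.
have [vW|vW] := boolP (v \in W).
  by case: eqP => // /setP/(_ v); rewrite !inE vf vW.
have [//|/set0Pn[w]] := eqVneq; rewrite inE => /andP[wf wW].
apply/tpermD; apply: contraNneq vW => ef; apply: (clW f w v) => //;
  by rewrite ef eqxx ?orbT.
Qed.

Lemma kempe_other c a b W f : c f != a -> c f != b -> kempe c a b W f = c f.
Proof. by rewrite /kempe; case: ifP => // _ na nb; rewrite tpermD // eq_sym. Qed.

Lemma kempe_ab c a b W f :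
  (kempe c a b W f == a) || (kempe c a b W f == b) = (c f == a) || (c f == b).
Proof.
by rewrite /kempe; case: ifP => // _; case: tpermP => [->|->|/eqP/negPf-> /eqP/negPf->];
  rewrite ?eqxx ?orbT.
Qed.

Lemma kempe_proper c a b W :
  kclosed c a b W -> proper_on F c -> proper_on F (kempe c a b W).
Proof.
move=> clW pc f g v fF gF vf vg.
rewrite (kempeE clW fF vf) (kempeE clW gF vg).
by case: ifP => _ => [/perm_inj|]; apply: pc vf vg.
Qed.

Lemma miss_kempe c a b W v d : kclosed c a b W ->
  (d \in miss (kempe c a b W) v) =
  if v \in W then tperm a b d \in miss c v else d \in miss c v.
Proof.
move=> clW; case: ifP => vW; apply/missP/missP => H f fF vf.
- move=> cf; apply: (H f fF vf); rewrite (kempeE clW fF vf) vW cf tpermK //.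
- rewrite (kempeE clW fF vf) vW => cf; apply: (H f fF vf).
  by rewrite -cf tpermK.
- by move=> cf; apply: (H f fF vf); rewrite (kempeE clW fF vf) vW.
- by rewrite (kempeE clW fF vf) vW; apply: H.
Qed.

Lemma miss_kempe_other c a b W v d : kclosed c a b W -> d != a -> d != b ->
  (d \in miss (kempe c a b W) v) = (d \in miss c v).
Proof.
by move=> clW na nb; rewrite miss_kempe // tpermD 1?eq_sym // if_same.
Qed.

Lemma bicolored_deg2 c a b u v w t : proper_on F c ->
  bicolored c a b u v -> bicolored c a b u w -> bicolored c a b u t ->
  [|| v == w, v == t | w == t].
Proof.
move=> pc /bicoloredP[f [fF cf ef]] /bicoloredP[g [gF cg eg]].
move=> /bicoloredP[h [hF ch eh]].
have same f' g' v' w' : f' \in F -> g' \in F -> ends f' = [set u; v'] ->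
    ends g' = [set u; w'] -> c f' = c g' -> v' == w'.
  move=> f'F g'F ef' eg' cfg; apply/eqP/(@set2_inj _ u); rewrite -ef' -eg'.
  by congr ends; apply: (pc f' g' u) => //; rewrite ?ef' ?eg' set21.
case/orP: cf => /eqP cf; case/orP: cg => /eqP cg; case/orP: ch => /eqP ch;
  first [ by rewrite (same f g v w) ?cf ?cg
        | by rewrite (same f h v t) ?orbT ?cf ?ch
        | by rewrite (same g h w t) ?orbT ?cg ?ch].
Qed.

Lemma miss_pendant c a b v : proper_on F c ->
  (a \in miss c v) || (b \in miss c v) -> pendant (bicolored c a b) v.
Proof.
move=> pc mv u w /bicoloredP[f [fF cf ef]] /bicoloredP[g [gF cg eg]].
have vf : v \in ends f by rewrite ef set21.
have vg : v \in ends g by rewrite eg set21.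
apply: (@set2_inj _ v); rewrite -ef -eg; congr ends; apply: (pc f g v) => //.
case/orP: mv => /missP mv; have := mv f fF vf; have := mv g gF vg;
  case/orP: cf => /eqP cf; case/orP: cg => /eqP cg; congruence.
Qed.

Lemma kchain_sym c a b u v : (u \in kchain c a b v) = (v \in kchain c a b u).
Proof. by rewrite !inE (sym_connect_sym (bicolored_sym c a b)). Qed.

(** Vertices missing [a] or [b] are pendant in the two-coloured graph, and a component holds at most
    two of them. *)
Lemma kchain_third c a b u v w : proper_on F c ->
    (a \in miss c u) || (b \in miss c u) ->
    (a \in miss c v) || (b \in miss c v) ->
    (a \in miss c w) || (b \in miss c w) ->
    u != v -> w != u -> w != v -> v \in kchain c a b u ->
  (u \notin kchain c a b w) && (v \notin kchain c a b w).
Proof.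
move=> pc /(miss_pendant pc) pu /(miss_pendant pc) pv /(miss_pendant pc) pw.
move=> neq_uv neq_wu neq_wv uv.
have nw u' v' : pendant (bicolored c a b) u' -> pendant (bicolored c a b) v' ->
    u' != v' -> w != u' -> w != v' -> v' \in kchain c a b u' ->
    u' \notin kchain c a b w.
  move=> pu' pv' neq' neqw' neqw conn.
  rewrite kchain_sym inE; apply: (@pendant_connect _ _ _ _ u' v') => //.
  - exact: bicolored_sym.
  - by move=> ? ? ? ?; apply: bicolored_deg2.
  - by rewrite inE in conn.
by rewrite (nw u v) // (nw v u) // 1?eq_sym // kchain_sym.
Qed.

End PartialColorings.

(** * Tashkinov's theorem *)

Section Trees.
Variables (G : multigraph) (k d : nat) (F : {set edge G}) (e : edge G).
Local Notation V := (vertex G).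
Local Notation E := (edge G).
Implicit Types (c : E -> 'I_k) (a b : 'I_k) (W : {set V}).
Implicit Types (u v w x y z : V) (f g : E) (s t B D S tl : seq (V * E)).

Local Notation miss := (miss F).
Local Notation proper := (proper_on F).
Local Notation kclosed := (kclosed F).
Local Notation kchain := (kchain F).

Hypothesis e_notin_F : e \notin F.
Hypothesis d_gt0 : 0 < d.
Hypothesis deg_le : forall v, #|[set f in e |: F | v \in ends f]| + d <= k.
Hypothesis F_max : forall c, ~ proper_on (e |: F) c.

Lemma card_miss c v : k <= #|miss c v| + #|[set f in F | v \in ends f]|.
Proof.
have sub : ~: miss c v \subset c @: [set f in F | v \in ends f].
  apply/subsetP=> a; rewrite inE => /missPn[f [fF vf <-]].
  by rewrite imset_f // inE fF.
rewrite -{1}(card_ord k) -(cardsC (miss c v)) leq_add2l.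
exact: leq_trans (subset_leq_card sub) (leq_imset_card _ _).
Qed.

(** The edge [e] counts in [deg_le] but has no colour, so its ends miss one colour more. *)
Lemma card_miss_ge c v : d + (v \in ends e) <= #|miss c v|.
Proof.
have := card_miss c v; have := deg_le v.
have -> : [set f in e |: F | v \in ends f] =
    (if v \in ends e then [set e] else set0) :|: [set f in F | v \in ends f].
  apply/setP=> f; rewrite !inE; case: ifP => ve; rewrite !inE ?andb_orl;
  case: (f =P e) => [->|]; rewrite ?ve ?andbT ?andbF //.
rewrite cardsU; have -> : (if v \in ends e then [set e] else set0) :&:
    [set f in F | v \in ends f] = set0.
  apply/setP=> f; rewrite !inE; case: ifP => _; rewrite !inE //.
  by case: eqP => [->|]; rewrite ?(negPf e_notin_F).
case: ifP => _ /=; rewrite ?cards1 !cards0. 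
  by move: #|miss c v| #|[set f in F | v \in ends f]| => m n; lia.
by move: #|miss c v| #|[set f in F | v \in ends f]| => m n; lia.
Qed.

Lemma miss_exists c v : exists a, a \in miss c v.
Proof.
apply/set0Pn; rewrite -card_gt0.
by apply: leq_trans (card_miss_ge c v); rewrite addn_gt0 d_gt0.
Qed.

(** * Trees on the uncoloured edge, and Kierstead's theorem for paths *)

Section Root.
Variables x y : V.
Hypothesis ends_e : ends e = [set x; y].

(* A tree is the list of its vertices other than the ends [x], [y] of the
   uncoloured edge, latest first, each with the edge that attaches it. *)
Fixpoint verts s : seq V := if s is p :: s' then p.1 :: verts s' else [:: y; x].

Definition used c s : seq 'I_k := [seq c p.2 | p <- s].

(** The default [y] makes a path on the empty tree start at [y]. *)
Definition top s : V := head y (map fst s).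

(** A Tashkinov tree: the colour of a new edge is missing at some earlier vertex, not necessarily at
    the one where the edge is attached. *)
Fixpoint valid c s : Prop :=
  if s is (z, f) :: s' then
    [/\ valid c s', f \in F, z \notin verts s',
        exists2 v, v \in verts s' & ends f = [set v; z]
      & exists2 u, u \in verts s' & c f \in miss c u]
  else True.

(* [t ++ s] ends with the path [t], starting at the last vertex of [s]. *)
Fixpoint linked t s : bool :=
  if t is (z, f) :: t' then (top (t' ++ s) \in ends f) && linked t' s else true.

Definition elementary c s := forall u v a,
  u \in verts s -> v \in verts s -> a \in miss c u -> a \in miss c v -> u = v.

(** Quantified over [c], so that it still applies to [s] after a Kempe change that keeps [s]
    valid. *)
Definition good s := forall c, proper c -> valid c s -> elementary c s.

Lemma mem_verts_cat u t s :
  (u \in verts (t ++ s)) = (u \in map fst t) || (u \in verts s).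
Proof. by elim: t => //= -[z f] t IH; rewrite !inE IH orbA. Qed.

Lemma top_verts s : top s \in verts s.
Proof. by case: s => [|[z f] s]; rewrite mem_head. Qed.

Lemma linked_cat t1 t2 s : linked (t1 ++ t2) s = linked t1 (t2 ++ s) && linked t2 s.
Proof. by elim: t1 => //= -[z f] t IH; rewrite IH catA andbA. Qed.

Lemma valid_cat c t s : valid c (t ++ s) -> valid c s.
Proof. by elim: t => //= -[z f] t IH [] /IH. Qed.

Lemma valid_uniq c s : valid c s -> uniq (verts s).
Proof.
elim: s => [_|[z f] s IH /= [/IH Us _ zs _ _]]; last by rewrite zs.
by rewrite /= inE eq_sym (ends_neq ends_e).
Qed.

Lemma valid_edge c s p : valid c s -> p \in s ->
  p.2 \in F /\ {subset ends p.2 <= verts s}.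
Proof.
elim: s => // -[z f] s IH /= [/IH vs fF _ [v vs' ef] _].
rewrite inE => /orP[/eqP->|/vs[pF sub]] /=.
  split=> // u; rewrite ef !inE => /orP[]/eqP->.
    by rewrite vs' orbT.
  by rewrite eqxx.
by split=> // u /sub; rewrite /= inE => ->; rewrite orbT.
Qed.

Lemma elementary_cons c z f s : elementary c s ->
    (forall u a, u \in verts s -> a \in miss c z -> a \in miss c u -> False) ->
  elementary c ((z, f) :: s).
Proof.
move=> els Hz u v a; rewrite /= !inE.
move=> /orP[/eqP->|us] /orP[/eqP->|vs] au av //.
- by have := Hz _ _ vs au av.
- by have := Hz _ _ us av au.
- exact: els au av.
Qed.

Lemma elementary_cat c t s : elementary c (t ++ s) -> elementary c s.
Proof.
move=> el u v a us vs; apply: el; rewrite mem_verts_cat ?us ?vs orbT //.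
Qed.

(* The colours of a tree are missing at vertices other than its last one. *)
Lemma top_unused c s a : valid c s -> elementary c s ->
  a \in miss c (top s) -> a \notin used c s.
Proof.
case: s => // -[v g] s val el av; apply/mapP => -[p ps a_p].
have {ps} [u us pu] : exists2 u, u \in verts s & c p.2 \in miss c u.
  move: val => [val _ _ _ [u us cu]]; move: ps.
  rewrite inE => /orP[/eqP->|ps]; first by exists u.
  elim: s {el av u us cu} val ps => // -[z f] s IH /= [val _ _ _ [u us cu]].
  rewrite inE => /orP[/eqP->|/(IH val)[u' u's ?]].
    by exists u; rewrite // /= inE us orbT.
  by exists u'; rewrite // /= inE u's orbT.
move: val => [_ _ + _ _]; rewrite (el v u a) ?us //.
- by rewrite /= mem_head.
- by rewrite /= inE us orbT.
- by rewrite a_p.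
Qed.

Lemma valid_kempe_unused c a b W s : kclosed c a b W -> valid c s ->
  a \notin used c s -> b \notin used c s -> valid (kempe c a b W) s.
Proof.
move=> clW; elim: s => // -[z f] s IH /= [val fF zs adj [u us cu]].
rewrite !inE !negb_or => /andP[acf a_s] /andP[bcf b_s].
split=> //; [exact: IH | exists u => //].
rewrite kempe_other 1?eq_sym // miss_kempe_other // eq_sym //.
Qed.

Lemma valid_kempe_disjoint c a b W s : kclosed c a b W -> valid c s ->
  {in verts s, forall v, v \notin W} -> valid (kempe c a b W) s.
Proof.
move=> clW; elim: s => // -[z f] s IH /= [val fF zs [v vs ef] [u us cu]] dis.
have dis' w : w \in verts s -> w \notin W.
  by move=> ws; apply: dis; rewrite /= inE ws orbT.
split=> //; [exact: IH | by exists v | exists u => //].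
have vf : v \in ends f by rewrite ef set21.
by rewrite (kempeE clW fF vf) miss_kempe // !ifN ?dis'.
Qed.

(** Edges of [t] in the two exchanged colours stay admissible, since both colours are missing in [s]
    afterwards. *)
Lemma valid_kempe_cat c a b W t s : kclosed c a b W ->
    valid c (t ++ s) -> valid (kempe c a b W) s ->
    (exists2 u, u \in verts s & a \in miss (kempe c a b W) u) ->
    (exists2 v, v \in verts s & b \in miss (kempe c a b W) v) ->
  valid (kempe c a b W) (t ++ s).
Proof.
move=> clW val vals [u us au] [v vs bv].
elim: t val => // -[z f] t IH /= [val fF zs adj [w ws cw]].
split=> //; first exact: IH.
have [] := boolP ((c f == a) || (c f == b)).
  rewrite -(kempe_ab c a b W) => /orP[/eqP->|/eqP->].
    by exists u; rewrite // mem_verts_cat us orbT.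
  by exists v; rewrite // mem_verts_cat vs orbT.
rewrite negb_or => /andP[na nb]; exists w => //.
by rewrite kempe_other // miss_kempe_other.
Qed.

(** A colour missing at both ends of [e] could be given to [e]. *)
Lemma good_nil : good [::].
Proof.
move=> c pc _ u v a; rewrite /= !inE.
suff cont : a \in miss c x -> a \in miss c y -> False.
  by case/orP=> /eqP->; case/orP=> /eqP-> // p q; case: cont.
move=> ax ay; pose c' f := if f == e then a else c f.
apply: (F_max (c := c')) => f g w.
have mis h : h \in F -> w \in ends h -> w \in ends e -> c h <> a.
  move=> hF wh; rewrite ends_e !inE => /orP[]/eqP eq_w.
    by apply: (missP _ _ _ _ ax) => //; rewrite -eq_w.
  by apply: (missP _ _ _ _ ay) => //; rewrite -eq_w.
rewrite !inE /c'; have [->|nfe] := eqVneq f e; have [->|nge] := eqVneq g e => //=.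
- by move=> _ gF we wg /esym; case/mis.
- by move=> fF _ wf we; case/mis.
- by move=> fF gF; apply: pc.
Qed.

Lemma valid_ext c c' s :
    {in s, forall p, c' p.2 = c p.2} ->
    {in s, forall p u, c p.2 \in miss c u -> c p.2 \in miss c' u} ->
  valid c s -> valid c' s.
Proof.
elim: s => // -[z f] s IH eqc mono /= [val fF zs adj [u us cu]].
have cf := eqc (z, f) (mem_head _ _); rewrite /= in cf.
split=> //.
  by apply: IH val => p ps; [apply: eqc | apply: mono]; rewrite inE ps orbT.
by exists u => //; rewrite cf; apply: (mono (z, f) (mem_head _ _)).
Qed.

Lemma recolor_last c z f s a v : proper c -> valid c ((z, f) :: s) ->
    v \in ends f -> v \in verts s -> a \in miss c z -> a \in miss c v ->
    a \notin used c s ->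
  ~ good s.
Proof.
move=> pc [val fF zs [v0 v0s ef] [u us cu]] vf vs az av a_s good_s.
have {v0 v0s ef vf} ef : ends f = [set v; z].
  have := vf; rewrite {1}ef !inE => /orP[]/eqP eq_v; first by rewrite eq_v.
  by rewrite -eq_v vs in zs.
pose c' g := if g == f then a else c g.
have miss_f g w : g \in F -> w \in ends g -> w \in ends f -> c g <> a.
  move=> gF wg; rewrite ef !inE => /orP[]/eqP eq_w.
    by apply: (missP _ _ _ _ av) => //; rewrite -eq_w.
  by apply: (missP _ _ _ _ az) => //; rewrite -eq_w.
have vf : v \in ends f by rewrite ef set21.
have pc' : proper c'.
  move=> g h w gF hF; rewrite /c'.
  have [->|ngf] := eqVneq g f; have [->|nhf] := eqVneq h f => //.
  - by move=> wf wh /esym /(miss_f h w hF wh wf).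
  - by move=> wg wf /(miss_f g w gF wg wf).
  - exact: pc.
have mono b w : b != a -> b \in miss c w -> b \in miss c' w.
  move=> ba /missP bw; apply/missP => g gF wg; rewrite /c'.
  by case: ifP => _; [apply/eqP; rewrite eq_sym | apply: bw].
have cfa : c f != a by apply/eqP/(miss_f f v).
have val' : valid c' s.
  apply: valid_ext (val) => [p ps|p ps w].
    rewrite /c' ifN //; apply: contraNneq zs => eq_p.
    by have [_] := valid_edge val ps; apply; rewrite eq_p ef set22.
  by apply: mono; apply: contraNneq a_s => <-; apply: map_f.
have cfv : c f \in miss c' v.
  apply/missP => g gF vg; rewrite /c'; case: eqP => [_|nfg cgf].
    by apply/eqP; rewrite eq_sym.
  by apply: nfg; apply: pc vg vf cgf.
have /missP/(_ f fF) := cu; case=> //.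
by rewrite (good_s c' pc' val' u v (c f)) // mono.
Qed.

(** Otherwise a change on the chain of [w] makes [a] missing at both [u] and [w], while [B], which
    uses neither colour, stays valid. *)
Lemma missing_linked B c a b u w : good B -> proper c -> valid c B ->
    u \in verts B -> w \in verts B -> a \in miss c u -> b \in miss c w ->
    a \notin used c B -> b \notin used c B -> u != w ->
  w \in kchain c a b u.
Proof.
move=> goodB pc val uB wB au bw a_B b_B.
rewrite kchain_sym; apply: contraNT => nlink.
have clW := @kchain_closed _ _ F c a b w.
apply/eqP/(goodB (kempe c a b (kchain c a b w))) => //.
- exact: kempe_proper.
- exact: valid_kempe_unused.
- by rewrite miss_kempe // (negPf nlink); apply: au.
- by rewrite miss_kempe // mem_kchain tpermL.
Qed.

Lemma outside_kchain B c a b u w z : good B -> proper c -> valid c B ->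
    u \in verts B -> w \in verts B -> a \in miss c u -> b \in miss c w ->
    a \notin used c B -> b \notin used c B -> u != w ->
    z \notin verts B -> a \in miss c z ->
  (u \notin kchain c a b z) && (w \notin kchain c a b z).
Proof.
move=> goodB pc val uB wB au bw a_B b_B neq_uw z_B az.
apply: kchain_third => //; rewrite ?au ?bw ?az ?orbT //.
- by apply: contraNneq z_B => ->.
- by apply: contraNneq z_B => ->.
- exact: (missing_linked goodB).
Qed.

(** The change on the chain of [z], which contains neither [u] nor [top B], trades the colour shared
    with [u] for one shared with [top B]. *)
Lemma push c z f t B a u : good B -> proper c -> valid c ((z, f) :: t ++ B) ->
    a \in miss c z -> u \in verts B -> a \in miss c u -> a \notin used c B ->
  exists c' b, [/\ proper c', valid c' ((z, f) :: t ++ B), b \in miss c' z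
                 & b \in miss c' (top B)].
Proof.
move=> goodB pc val az uB au a_B.
have [eq_u|neq_u] := eqVneq u (top B); first by exists c, a; rewrite -eq_u.
have valB : valid c B by apply: (@valid_cat _ ((z, f) :: t)).
have [b bt] := miss_exists c (top B).
have b_B := top_unused valB (goodB c pc valB) bt.
have z_B : z \notin verts B.
  by case: val => _ _ + _ _; rewrite mem_verts_cat negb_or => /andP[].
have /andP[uz tz] := outside_kchain goodB pc valB uB (top_verts B) au bt a_B b_B
  neq_u z_B az.
have clW := @kchain_closed _ _ F c a b z.
exists (kempe c a b (kchain c a b z)), b; split.
- exact: kempe_proper.
- apply: (@valid_kempe_cat c a b _ ((z, f) :: t) B) => //.
  + exact: valid_kempe_unused.
  + by exists u; rewrite // miss_kempe // ifN.
  + by exists (top B); rewrite ?top_verts // miss_kempe // ifN.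
- by rewrite miss_kempe // mem_kchain tpermR.
- by rewrite miss_kempe // ifN.
Qed.

(** The shared colour is pushed along [t], one vertex at a time; once it is missing at the neighbour
    of [z], [recolor_last] applies. *)
Lemma kierstead_push z f t B c a :
    (forall t1 t2, t = t1 ++ t2 -> good (t2 ++ B)) -> linked ((z, f) :: t) B ->
    proper c -> valid c ((z, f) :: t ++ B) ->
    a \in miss c z -> a \in miss c (top B) -> False.
Proof.
elim/last_ind: t B c a => [|t [w g] IH] B c a good_t lnk pc val az at_.
  have goodB : good B by apply: (good_t [::] [::]).
  have valB : valid c B by case: val.
  apply: (@recolor_last c z f B a (top B)) => //.
  - by case/andP: lnk.
  - exact: top_verts.
  - exact: top_unused valB (goodB c pc valB) at_.
rewrite -cats1 -catA /= in val.
have goodB' : good ((w, g) :: B).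
  by rewrite -[_ :: _]/([:: (w, g)] ++ B); apply: (good_t t); rewrite cats1.
have good_t' t1 t2 : t = t1 ++ t2 -> good (t2 ++ (w, g) :: B).
  by move=> def_t; rewrite -cat_rcons; apply: (good_t t1); rewrite def_t rcons_cat.
have /andP[lnk' /andP[wg _]] : linked ((z, f) :: t) ((w, g) :: B) &&
    linked [:: (w, g)] B.
  by move: lnk; rewrite -rcons_cons -cats1 linked_cat.
have val' : valid c ((w, g) :: B) by apply: (@valid_cat _ ((z, f) :: t)).
have goodB : good B by have := good_t (rcons t (w, g)) [::]; rewrite cats0; apply.
have [c' [b [pc' valc' bz bw]]] : exists c' b, [/\ proper c',
    valid c' ((z, f) :: t ++ (w, g) :: B), b \in miss c' z
    & b \in miss c' (top ((w, g) :: B))].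
  apply: push goodB' (pc) val az _ (at_) _ => /=.
    by rewrite inE top_verts orbT.
  (* The colour [a] is not that of [g] either, as [g] ends at [top B], where [a] is missing. *)
  have [valB gF _ _ _] := val'.
  rewrite inE negb_or (top_unused valB (goodB c pc valB) at_) andbT.
  by apply/eqP => ag; have /missP/(_ g gF wg) := at_; rewrite ag.
exact: (IH ((w, g) :: B) c' b good_t' lnk' pc' valc' bz bw).
Qed.

Lemma split_top t s u : u \in map fst t ->
  exists t1 t2, t = t1 ++ t2 /\ top (t2 ++ s) = u.
Proof.
elim: t => //= -[z f] t IH; rewrite inE => /orP[/eqP->|/IH[t1 [t2 [-> top_u]]]].
  by exists [::], ((z, f) :: t).
by exists ((z, f) :: t1), t2.
Qed.

(** Kierstead's theorem, by induction on the length. A colour shared with [x] or [y] is first pushed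
    to [y]; then [kierstead_push] applies, as it does at once for other vertices. *)
Lemma kierstead t : linked t [::] -> good t.
Proof.
have [n] := ubnP (size t); elim: n t => // n IH [|[z f] t] /=.
  by move=> _ _; apply: good_nil.
rewrite ltnS => le_t lnk c pc val.
have good_suf t1 t2 : t = t1 ++ t2 -> good t2.
  move=> def_t; apply: IH; first by rewrite def_t size_cat in le_t; lia.
  by case/andP: lnk => _; rewrite def_t linked_cat => /andP[].
have good_t : good t by apply: (good_suf [::]).
apply: elementary_cons; first by apply: good_t => //; case: val.
move=> u a + az au; rewrite -[t in verts t]cats0 mem_verts_cat.
case/orP=> [/(split_top [::])[t1 [t2 [def_t]]]|u_root].
  rewrite cats0 => top_u; rewrite -{u}top_u in au.
  apply: (@kierstead_push z f t1 t2 c a) => //; last by rewrite -def_t.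
    by move=> l1 l2 def_t1; apply: (good_suf l1); rewrite def_t def_t1 catA.
  have : linked ((z, f) :: t) [::] by [].
  by rewrite def_t -cat_cons linked_cat cats0 => /andP[].
have val0 : valid c ((z, f) :: t ++ [::]) by rewrite cats0.
have [c' [b [pc' val' bz by_]]] := push good_nil pc val0 az u_root au isT.
apply: (@kierstead_push z f t [::] c' b) => //.
by move=> l1 l2 def_t; rewrite cats0; apply: (good_suf l1).
Qed.

Lemma valid_path c a b s v p :
    valid c s -> v = top s ->
    path (bicolored F c a b) v p -> uniq p -> all (predC (mem (verts s))) p ->
    (exists2 u, u \in verts s & a \in miss c u) ->
    (exists2 w, w \in verts s & b \in miss c w) ->
  exists t, [/\ valid c (t ++ s), linked t s & map fst t = rev p].
Proof.
elim: p s v => [|z p IH] s v vals def_v /=; first by exists [::].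
move=> /andP[/bicoloredP[f [fF cf ef]] r_p] /andP[z_p Up] /andP[z_s p_s].
move=> [u us au] [w ws bw].
have vals' : valid c ((z, f) :: s).
  split=> //; first by exists v; rewrite // def_v top_verts.
  by case/orP: cf => /eqP->; [exists u | exists w].
have [|||t [valt lnk def_p]] := IH ((z, f) :: s) z vals' erefl r_p Up.
- apply/allP => i ip /=; rewrite inE negb_or.
  by have /allP/(_ i ip)/= -> := p_s; rewrite andbT; apply: contraNneq z_p => <-.
- by exists u; rewrite // inE us orbT.
- by exists w; rewrite // inE ws orbT.
exists (rcons t (z, f)); rewrite cat_rcons -cats1 linked_cat lnk /=.
by rewrite ef -def_v set21 cats1 map_rcons def_p rev_cons.
Qed.

Definition allmiss c s : {set 'I_k} :=
  [set a | has (fun v => a \in miss c v) (verts s)].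

Lemma card_allmiss c s : valid c s -> elementary c s ->
  (size s).+2 * d + 2 <= #|allmiss c s|.
Proof.
move=> val; have := valid_uniq val.
elim: s {val} => [|[z f] s IH] U el.
  have -> : allmiss c [::] = miss c y :|: miss c x.
    by apply/setP=> a; rewrite !inE /= orbF.
  have dis : miss c y :&: miss c x = set0.
    apply/setP=> a; rewrite !inE; apply/negP=> /andP[ay ax].
    have := ends_neq ends_e; rewrite (el x y a) ?eqxx //= ?inE ?eqxx ?orbT //.
  rewrite cardsU dis cards0 subn0.
  have := card_miss_ge c x; have := card_miss_ge c y.
  by rewrite ends_e !inE !eqxx orbT /= => ley lex; have := leq_add ley lex; lia.
have -> : allmiss c ((z, f) :: s) = miss c z :|: allmiss c s.
  by apply/setP=> a; rewrite !inE.
have dis : miss c z :&: allmiss c s = set0.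
  apply/setP=> a; rewrite !inE; apply/negP=> /andP[az /hasP[v vs av]].
  by move: U; rewrite /= (el z v a) ?vs ?mem_head // inE vs orbT.
rewrite cardsU dis cards0 subn0; have lez := card_miss_ge c z.
have /andP[_ Us] := U; have els := elementary_cat (t := [:: (z, f)]) el.
by have := IH Us els; move: lez; rewrite /=; lia.
Qed.

(** As [d] is positive, the tree misses at least [size s + 4] colours in all. *)
Lemma fresh_color c s (X : seq 'I_k) : valid c s -> elementary c s ->
    size X <= (size s).+2 -> exists2 u, u \in verts s & exists2 b, b \in miss c u & b \notin X.
Proof.
move=> val el leX; have := card_allmiss val el.
have le1 : size s + 4 <= (size s).+2 * d + 2 by case: d d_gt0 => // d' _; nia.
move=> le2; have lt : #|X| < #|allmiss c s|.
  apply: leq_trans le2; apply: leq_trans le1; rewrite addn4 ltnS.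
  by apply: leq_trans (card_size X) _; apply: leq_trans leX _.
have /subsetPn[b + bX] : ~~ (allmiss c s \subset X).
  by apply: contraTN lt => /subset_leq_card; rewrite -leqNgt.
by rewrite inE => /hasP[u us bu]; exists u => //; exists b.
Qed.

End Root.

(** * From paths to trees *)

Lemma verts_swap x y s u : (u \in verts x y s) = (u \in verts y x s).
Proof. by elim: s => [|p s IH] /=; rewrite !inE ?IH // orbC. Qed.

Lemma valid_swap x y c s : valid x y c s -> valid y x c s.
Proof.
elim: s => // -[z f] s IH /= [val fF zs [v vs ef] [u us cu]].
by split; rewrite 1?verts_swap //; [exact: IH | exists v | exists u];
  rewrite // verts_swap.
Qed.

Lemma good_swap x y s : good x y s -> good y x s.
Proof.
move=> good_s c pc /valid_swap val u v a.
by rewrite !(verts_swap y x); apply: good_s.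
Qed.

(* The size of the part [s] of the tree [t ++ s] is the main induction
   parameter, the length of the tail [t] only the second one: an alternating
   chain from the last vertex of the tree back to [C] can then replace [t],
   however long it is, because [y1] is dropped from [C] or joins the tail. *)
Section Step.
Variables (x y : V) (m : nat) (z1 y1 : V) (f1 g1 : E) (D : seq (V * E)).
Hypothesis ends_e : ends e = [set x; y].
Local Notation verts := (verts x y).
Local Notation valid := (valid x y).
Local Notation linked := (linked y).
Local Notation good := (good x y).
Local Notation top := (top y).

Hypothesis size_D : size D = m.
Hypothesis IHm : forall t s, size s = m.+1 -> linked t s -> good (t ++ s).
Let C := (y1, g1) :: D.
Let S := (z1, f1) :: C.

Let goodC : good C.
Proof. by apply: (IHm (t := [::])); rewrite //= size_D. Qed.

(** The chain of [y1] ends at [l] and avoids [z], so its change moves the colour shared by [z] and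
    [y1] to [l] in [D]. The list [X] holds colours that [b] must avoid. *)
Lemma normalize c a z f t (X : seq 'I_k) :
    proper c -> valid c ((z, f) :: t ++ C) -> a \in miss c z ->
    a \in miss c y1 -> {subset used c C <= X} -> size X <= m.+2 ->
  exists2 b, b \notin X & exists2 l, l \in verts D &
    let c' := kempe c a b (kchain c a b y1) in
    [/\ proper c', valid c' ((z, f) :: t ++ C), a \in miss c' z
      & a \in miss c' l].
Proof.
move=> pc val az ay subX leX.
have valC : valid c C by apply: (@valid_cat _ _ _ ((z, f) :: t)).
have elC := goodC pc valC.
have a_C := top_unused valC elC ay.
have [valD _ y_D _ _] := valC.
rewrite -size_D in leX.
have [l lD [b bl bX]] := fresh_color ends_e valD (elementary_cat (t := [:: (y1, g1)]) elC) leX.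
have b_C : b \notin used c C by apply: contra bX => /subX.
have lC : l \in verts C by rewrite /= inE lD orbT.
have yC : y1 \in verts C by rewrite /= mem_head.
have neq_yl : y1 != l by apply: contraNneq y_D => ->.
have link : l \in kchain c a b y1 by apply: (missing_linked goodC).
have z_C : z \notin verts C.
  by case: val => _ _ + _ _; rewrite mem_verts_cat negb_or => /andP[].
have /andP[yz lz] : (y1 \notin kchain c a b z) && (l \notin kchain c a b z).
  by apply: (outside_kchain goodC).
have clW := @kchain_closed _ _ F c a b y1.
exists b => //; exists l => //= .
have al : a \in miss (kempe c a b (kchain c a b y1)) l.
  by rewrite miss_kempe // link tpermL.
split=> //.
- exact: kempe_proper.
- apply: (@valid_kempe_cat _ _ c a b _ ((z, f) :: t) C) => //.
  + exact: valid_kempe_unused.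
  + by exists l.
  + by exists y1; rewrite // miss_kempe // mem_kchain tpermR.
- by rewrite miss_kempe // kchain_sym (negPf yz).
Qed.

Hypothesis y1_f1 : y1 \notin ends f1.

Lemma last_color_missing c a u w : proper c -> valid c S -> a \in miss c z1 ->
    w \in verts D -> a \in miss c w -> u \in verts D -> c f1 \in miss c u ->
  False.
Proof.
move=> pc [valC f1F z1_C [v vC ef] _] az wD aw uD cu.
have vD : v \in verts D.
  by move: vC; rewrite /= inE => /orP[/eqP eq_v|//]; have := y1_f1; rewrite -eq_v ef set21.
have [valD _ _ _ _] := valC.
have z1_D : z1 \notin verts D by move: z1_C; rewrite /= inE negb_or => /andP[].
have val' : valid c ((z1, f1) :: D) by split=> //; [exists v | exists u].
have good' : good ((z1, f1) :: D).
  by apply: (IHm (t := [::])); rewrite //= size_D.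
move: z1_D; rewrite (good' c pc val' z1 w a) ?wD //= ?mem_head //.
by rewrite inE wD orbT.
Qed.

(** If the colour of [f1] is missing at [y1], a change on the chain of [z1] recolours [f1] with [a],
    missing at [w]. Now [z1] and [y1] share the old colour, and [normalize] moves it into [D]. *)
Lemma last_unused c a w : proper c -> valid c S -> a \in miss c z1 ->
    w \in verts D -> a \in miss c w -> a \notin used c C -> False.
Proof.
move=> pc val az wD aw a_C.
have valC : valid c C by case: val.
have [_ f1F z1_C [v vC ef] [u + cu]] := val.
rewrite /= inE => /orP[/eqP eq_u|uD]; last exact: last_color_missing az wD aw uD cu.
rewrite {u}eq_u in cu.
have elC := goodC pc valC.
have c1_C := top_unused valC elC cu.
have yC : y1 \in verts C by rewrite /= mem_head.
have wC : w \in verts C by rewrite /= inE wD orbT.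
have neq_wy : w != y1 by case: valC => _ _ + _ _; apply: contraNneq => <-.
have /andP[wz yz] := outside_kchain goodC pc valC wC yC aw cu a_C c1_C neq_wy z1_C az.
have clW := @kchain_closed _ _ F c a (c f1) z1.
set c' := kempe c a (c f1) (kchain c a (c f1) z1).
have aw' : a \in miss c' w by rewrite miss_kempe // ifN.
have cy' : c f1 \in miss c' y1 by rewrite miss_kempe // ifN.
have z1f : z1 \in ends f1 by rewrite ef set22.
have c'f : c' f1 = a by rewrite /c' (kempeE clW f1F z1f) mem_kchain tpermR.
have cz' : c f1 \in miss c' z1 by rewrite miss_kempe // mem_kchain tpermR.
have val' : valid c' S.
  apply: (@valid_kempe_cat _ _ c a (c f1) _ [:: (z1, f1)] C) => //.
  + exact: valid_kempe_unused.
  + by exists w.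
  + by exists y1.
have pc' : proper c' by apply: kempe_proper.
have neq_ca : a != c f1.
  by apply/eqP => eq_a; have /missP/(_ f1 f1F z1f) := az; rewrite eq_a.
(* Avoiding [a] keeps [f1] in colour [a] and [a] missing at [w]. *)
have [||b bX [l lD [pc2 val2 cz2 cl2]]] :=
  @normalize c' (c f1) z1 f1 [::] (a :: used c' C) pc' val' cz' cy'.
- by move=> i iC; rewrite in_cons iC orbT.
- by rewrite /used /= size_map size_D.
have neq_ab : a != b by move: bX; rewrite inE negb_or eq_sym => /andP[].
apply: (last_color_missing pc2 val2 cz2 lD cl2 wD).
by rewrite kempe_other c'f // miss_kempe_other //; apply: kchain_closed.
Qed.

(** If the chain met [C], its part from the last vertex in [C] to [z] would be a tail on a base of
    size [m.+1], and by [IHm] the colour [a] could not be missing at both [w] and [z]. *)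
Lemma kchain_avoids c a b w l z : proper c -> valid c C ->
    w \in verts D -> l \in verts D -> a \in miss c w -> b \in miss c l ->
    z \notin verts C -> a \in miss c z ->
  {in verts C, forall v, v \notin kchain c a b z}.
Proof.
move=> pc valC wD lD aw bl z_C az v0 v0C; apply/negP.
rewrite kchain_sym inE => /connectP[p0 r_p0 last_p0].
case/shortenP: r_p0 last_p0 => p r_p Up _ last_p.
have [v [q [vC r_q Uq q_C]]] := path_exit (A := mem (verts C)) r_p Up v0C.
rewrite -last_p => last_q.
have [valD _ _ _ _] := valC.
have q0 : q != [::] by apply: contraNneq z_C => q0; rewrite -last_q q0.
have z_q : z \in q by case: q {Uq r_q q_C} last_q q0 => //= ? ? <- _; rewrite mem_last.
have cont s t : size s = m.+1 -> valid c (t ++ s) -> linked t s ->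
    {subset verts D <= verts s} -> z \in verts (t ++ s) -> False.
  move=> size_s val lnk sub zts.
  have wts : w \in verts (t ++ s) by rewrite mem_verts_cat sub ?orbT.
  have eq_z := IHm size_s lnk pc val zts wts az aw.
  by rewrite eq_z /= inE wD orbT in z_C.
have /andP[v_q Uq'] := Uq.
move: vC; rewrite [_ v]/= inE => /orP[/eqP eq_v|vD].
  have [||t [val lnk def_t]] := valid_path (s := C) valC eq_v r_q Uq' q_C.
  - by exists w; rewrite //= inE wD orbT.
  - by exists l; rewrite //= inE lD orbT.
  apply: (cont C t) => //=; first by rewrite size_D.
    by move=> i iD; rewrite inE iD orbT.
  by rewrite mem_verts_cat def_t mem_rev z_q.
case: q => // z' q in z_q Uq' r_q q_C q0 last_q v_q Uq *.
move: r_q Uq' q_C => /= /andP[/bicoloredP[f [fF cf ef]] r_q] /andP[z'_q Uq'].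
rewrite inE negb_or => /andP[/andP[_ z'_D] q_C].
(* The first vertex of the chain after [D] replaces [y1], so the base again has size [m.+1]. *)
have val' : valid c ((z', f) :: D).
  by split=> //; [exists v | case/orP: cf => /eqP->; [exists w | exists l]].
have [|||t [val lnk def_t]] := valid_path (s := (z', f) :: D) val' erefl r_q Uq'.
- apply/allP => i iq /=; rewrite inE negb_or.
  have /allP/(_ i iq) := q_C; rewrite /= inE negb_or => /andP[_ ->].
  by rewrite andbT; apply: contraNneq z'_q => <-.
- by exists w; rewrite //= inE wD orbT.
- by exists l; rewrite //= inE lD orbT.
apply: (cont ((z', f) :: D) t) => //=; first by rewrite size_D.
  by move=> i iD; rewrite inE iD orbT.
move: z_q; rewrite mem_verts_cat def_t mem_rev inE /= inE.
by case/orP=> ->; rewrite ?orbT.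
Qed.

(** Cases for the vertex [u] that shares a colour with the last vertex [z]: in [D] use [shared_D],
    at [y1] first [normalize], at [z1] or in the tail [kierstead_push]. *)
Lemma tashkinov_step t : linked t S -> good (t ++ S).
Proof.
have [n] := ubnP (size t); elim: n t => // n IH t; rewrite ltnS => le_t lnk.
have good_suf t1 t2 : t = t1 ++ t2 -> t1 != [::] -> good (t2 ++ S).
  move=> def_t t1_nil; apply: IH.
    case: t1 t1_nil def_t => // p t1 _ def_t.
    by move: le_t; rewrite def_t /= size_cat; lia.
  by move: lnk; rewrite def_t linked_cat => /andP[].
have [z [f [r def_T]]] : exists z f r, t ++ S = (z, f) :: r ++ C.
  case: t {IH le_t lnk good_suf} => [|[z f] t]; first by exists z1, f1, [::].
  by exists z, f, (rcons t (z1, f1)); rewrite cat_rcons.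
have valid_C c : valid c (t ++ S) -> valid c C.
  by rewrite def_T => /(@valid_cat _ _ _ ((z, f) :: r)).
(* The colour is pushed to [top S] and then along the tail; without a tail, [last_unused]
   applies. *)
have unused_D c a w : proper c -> valid c (t ++ S) -> a \in miss c z ->
    w \in verts D -> a \in miss c w -> a \notin used c S -> False.
  move=> pc val az wD aw a_S.
  case: t def_T lnk good_suf val {IH le_t valid_C} => [|[z' f'] t].
    case=> eq_z _ _ _ _ val; apply: (last_unused pc val _ wD aw); first by rewrite eq_z.
    by move: a_S; rewrite in_cons negb_or => /andP[].
  case=> eq_z _ _ lnk good_suf val; rewrite -{z}eq_z in az.
  have goodS : good S by have := good_suf ((z', f') :: t) [::]; rewrite cats0; apply.
  have wS : w \in verts S by rewrite /= !inE wD !orbT.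
  have [c' [b [pc' val' bz' bt]]] := push goodS pc val az wS aw a_S.
  apply: (kierstead_push _ lnk pc' val' bz' bt) => t1 t2 def_t.
  by apply: (good_suf ((z', f') :: t1)); rewrite ?def_t.
have shared_D c a w : proper c -> valid c (t ++ S) -> a \in miss c z ->
    w \in verts D -> a \in miss c w -> False.
  move=> pc val az wD aw; have valC := valid_C c val.
  have [valD _ _ _ _] := valC.
  have elD := elementary_cat (t := [:: (y1, g1)]) (goodC pc valC).
  have leX : size (used c S) <= (size D).+2 by rewrite size_map.
  have [l lD [b bl b_S]] := fresh_color ends_e valD elD leX.
  have z_C : z \notin verts C.
    by move: val; rewrite def_T /= mem_verts_cat negb_or => -[_ _ /andP[]].
  have dis := kchain_avoids pc valC wD lD aw bl z_C az.
  have clW := @kchain_closed _ _ F c a b z.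
  have out v : v \in verts D -> v \notin kchain c a b z.
    by move=> vD; apply: dis; rewrite /= inE vD orbT.
  have bl' : b \in miss (kempe c a b (kchain c a b z)) l.
    by rewrite miss_kempe // ifN ?out.
  apply: (unused_D (kempe c a b (kchain c a b z)) b l) => //.
  - exact: kempe_proper.
  - rewrite def_T; apply: (@valid_kempe_cat _ _ c a b _ ((z, f) :: r) C) => //.
    + by move: val; rewrite def_T.
    + exact: valid_kempe_disjoint.
    + by exists w; rewrite /= ?inE ?wD ?orbT // miss_kempe // ifN ?out.
    + by exists l; rewrite //= inE lD orbT.
  - by rewrite miss_kempe // mem_kchain tpermR.
  (* Every edge of [S] has an end in [C], hence off the chain. *)
  have -> // : used (kempe c a b (kchain c a b z)) S = used c S.
  apply/eq_in_map => p pS.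
  have valS : valid c S by apply: valid_cat val.
  suff [v vC vp] : exists2 v, v \in verts C & v \in ends p.2.
    have [pF _] := valid_edge valS pS.
    by rewrite (kempeE clW pF vp) ifN // dis.
  move: pS; rewrite inE => /orP[/eqP->|pC].
    by have [_ _ _ [v vC ef] _] := valS; exists v; rewrite //= ef set21.
  have [_ sub] := valid_edge valC pC.
  have /card_gt0P[v vp] : 0 < #|ends p.2| by rewrite card_ends.
  by exists v => //; apply: sub.
move=> c pc val; rewrite def_T; apply: elementary_cons.
  case: t def_T good_suf val {IH le_t lnk valid_C unused_D shared_D} => [|p t].
    by move=> [_ _ <-] _ /(@valid_cat _ _ _ [:: (z1, f1)]); apply: goodC.
  move=> [_ <-] good_suf /(@valid_cat _ _ _ [:: p]).
  by apply: (good_suf [:: p]).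
move=> u a u_r az au; have [uC|uC] := boolP (u \in verts C).
  move: uC; rewrite /= inE => /orP[/eqP eq_u|uD]; last exact: shared_D val az uD au.
  rewrite {u u_r}eq_u in au; have valT := val; rewrite def_T in valT.
  have subX : {subset used c C <= used c S} by move=> i iC; rewrite in_cons iC orbT.
  have [|b _ [l lD [pc' val' az' al']]] := normalize pc valT az au subX.
    by rewrite size_map /= size_D.
  by apply: (shared_D _ _ _ pc' _ az' lD al'); rewrite def_T.
case: t def_T lnk good_suf val {IH le_t valid_C unused_D shared_D} => [|[z' f'] t].
  by move=> [_ _ eq_r]; rewrite -eq_r (negPf uC) in u_r.
case=> eq_z _ eq_r lnk good_suf val; rewrite -{z}eq_z in az.
have {}good_suf t1 t2 : t = t1 ++ t2 -> good (t2 ++ S).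
  by move=> def_t; apply: (good_suf ((z', f') :: t1)); rewrite ?def_t.
move: u_r; rewrite -eq_r mem_verts_cat => /orP[/(split_top y S)|].
  case=> t1 [t2 [def_t top_u]]; rewrite -top_u in au.
  apply: (@kierstead_push x y z' f' t1 (t2 ++ S) c a) => //.
  - by move=> l1 l2 def_t1; rewrite catA; apply: (good_suf l1); rewrite def_t def_t1 catA.
  - by move: lnk; rewrite def_t -cat_cons linked_cat => /andP[].
  - by move: val; rewrite def_t /= catA.
rewrite [_ \in _]inE (negPf uC) orbF => /eqP eq_u; rewrite eq_u in au.
exact: (@kierstead_push x y z' f' t S c a).
Qed.

End Step.

Lemma linked_root x y t p s : linked x t (p :: s) = linked y t (p :: s).
Proof. by elim: t => // -[z f] [|q t] //= ->. Qed.

(** Induction on the size of the base, with tails of any length; bases with at most one edge give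
    Kierstead paths. *)
Theorem tashkinov x y s : ends e = [set x; y] -> good x y s.
Proof.
move=> ends_e; suff tree m t : size s = m -> linked y t s -> good x y (t ++ s).
  exact: (tree (size s) [::]).
elim: m t s => [|[|m] IH] t s.
- by move/eqP/nilP-> => lnk; rewrite cats0; apply: kierstead.
- case: s => [|[z f] [|//]] // _ lnk c pc val.
  have [_ fF _ [v vr ef] _] : valid x y c [:: (z, f)] by apply: valid_cat val.
  have vf : v \in ends f by rewrite ef set21.
  (* A first edge at [x] gives a path after [x] and [y] are exchanged. *)
  move: vr; rewrite !inE => /orP[]/eqP eq_v; rewrite eq_v in vf.
    by apply: kierstead => //; rewrite linked_cat lnk /= vf.
  apply: good_swap pc val; apply: kierstead; first by rewrite ends_e setUC.
  by rewrite linked_cat (linked_root x y) lnk /= vf.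
case: s => [|[z1 f1] [|[y1 g1] D]] // [size_D] lnk.
have [y1f|y1f] := boolP (y1 \in ends f1); last first.
  exact: (tashkinov_step ends_e size_D).
(* As [f1] meets [y1], the vertex [z1] joins the tail and the base shrinks. *)
rewrite -cat_rcons -cats1; apply: IH; first by rewrite /= size_D.
by rewrite linked_cat lnk /= y1f.
Qed.

End Trees.

(** * Growing trees with few colours *)

Section Parity.
Variables (G : multigraph) (k : nat) (F : {set edge G}).
Implicit Types (c : edge G -> 'I_k) (a b : 'I_k) (W : {set vertex G}).

(** The edges of colour [a] inside [W] partition it into pairs. *)
Lemma matched_even c a W : proper_on F c ->
    (forall v, v \in W -> exists f,
       [/\ f \in F, c f = a, v \in ends f & ends f \subset W]) ->
  ~~ odd #|W|.
Proof.
move=> pc match_W.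
pose P := [set ends f | f in [set f in F | (c f == a) && (ends f \subset W)]].
suff partP : partition P W.
  rewrite (card_uniform_partition _ partP (n := 2)) ?oddM ?andbF //.
  by move=> B /imsetP[f _ ->]; apply: card_ends.
apply/and3P; split.
- rewrite eqEsubset; apply/andP; split.
    by apply/bigcupsP => B /imsetP[f + ->]; rewrite inE => /and3P[].
  apply/subsetP => v /match_W[f [fF cf vf fW]]; apply/bigcupP.
  by exists (ends f) => //; apply: imset_f; rewrite inE fF cf eqxx.
- apply/trivIsetP => A B /imsetP[f + ->] /imsetP[g + ->].
  rewrite !inE => /and3P[fF /eqP cf _] /and3P[gF /eqP cg _] neq_fg.
  apply/pred0P => v /=; apply/negP => /andP[vf vg].
  by case/eqP: neq_fg; congr ends; apply: (pc f g v); rewrite ?cf ?cg.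
- apply/negP => /imsetP[f _ /esym]; apply/eqP.
  by rewrite -card_gt0 card_ends.
Qed.

Lemma kempe_eq_other c a b W f g : g != a -> g != b ->
  (kempe c a b W f == g) = (c f == g).
Proof.
move=> na nb; have [cf|] := boolP ((c f == a) || (c f == b)); last first.
  by rewrite negb_or => /andP[]; move=> *; rewrite kempe_other.
have := cf; rewrite -(kempe_ab c a b W) => cf'.
have neq h : (h == a) || (h == b) -> (h == g) = false.
  by case/orP=> /eqP->; rewrite eq_sym; apply/negbTE.
by rewrite !neq.
Qed.

End Parity.

Section Growth.
Variables (G : multigraph) (k d : nat) (F : {set edge G}) (e : edge G).
Local Notation V := (vertex G).
Local Notation E := (edge G).
Implicit Types (c : E -> 'I_k) (a b : 'I_k) (W : {set V}).
Implicit Types (u v w z : V) (f g : E) (s t : seq (V * E)).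

Local Notation miss := (miss F).
Local Notation proper := (proper_on F).
Local Notation kchain := (kchain F).

Hypothesis e_notin_F : e \notin F.
Hypothesis d_gt0 : 0 < d.
Hypothesis deg_le : forall v, #|[set f in e |: F | v \in ends f]| + d <= k.
Hypothesis F_max : forall c, ~ proper_on (e |: F) c.
Variables (x y : V).
Hypothesis ends_e : ends e = [set x; y].
Local Notation verts := (verts x y).
Local Notation valid := (valid F x y).

Let elem s c : proper c -> valid c s -> elementary F x y c s.
Proof. exact: (tashkinov e_notin_F d_gt0 deg_le F_max ends_e). Qed.

Lemma x_verts s : x \in verts s.
Proof. by elim: s => [|p s IH] /=; rewrite !inE ?eqxx ?IH orbT. Qed.

Lemma y_verts s : y \in verts s.
Proof. by elim: s => [|p s IH] /=; rewrite !inE ?eqxx ?IH ?orbT. Qed.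

Definition saturated c s a := forall f u v,
  f \in F -> c f = a -> u \in ends f -> v \in ends f ->
  u \in verts s -> v \in verts s.

(* [s] does not list [x] and [y], so that the tree has [r.*2.+1] vertices. *)
Definition frugal r c s := [/\ proper c, valid c s, (size s).+1 = r.*2,
  #|[set a in used c s]| <= r
  & exists a, [/\ a \in miss c x, a \in used c s & saturated c s a]].

Definition exits c s := exists f u v w,
  [/\ f \in F, u \in verts s, c f \in miss c u
    & [/\ v \in ends f, v \in verts s, w \in ends f & w \notin verts s]].

(** The edge at [y] in a colour missing at [x] gives the third vertex; it joins the two vertices
    other than [x], so this colour is saturated. *)
Lemma frugal_start c : proper c -> exists s, frugal 1 c s.
Proof.
move=> pc; have [a ax] := miss_exists e_notin_F d_gt0 deg_le c x.
have neq_xy := ends_neq ends_e.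
have : a \notin miss c y.
  apply: contra neq_xy => ay; apply/eqP.
  by apply: (@elem [::] c pc _ x y a); rewrite ?x_verts ?y_verts.
case/missPn => f [fF yf cf].
have [z neq_zy ef] := ends_other yf.
have neq_zx : z != x.
  apply/eqP => eq_z; have /missP/(_ f fF) := ax; apply => //.
  by rewrite -eq_z ef set22.
exists [:: (z, f)]; split=> //.
- split=> //; first by rewrite /= !inE negb_or neq_zy.
    by exists y; rewrite ?y_verts.
  by exists x; rewrite ?x_verts ?cf.
- have -> : [set b in used c [:: (z, f)]] = [set c f]; last by rewrite cards1.
  by apply/setP => b; rewrite !inE.
exists a; rewrite /used /= cf mem_head; split=> // g u v gF cg ug vg.
have eq_fg w : w \in ends f -> w \in ends g -> f = g.
  by move=> wf wg; apply: pc wf wg _; rewrite ?cf ?cg.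
have zf : z \in ends f by rewrite ef set22.
rewrite !inE => /or3P[]/eqP eq_u; rewrite eq_u in ug.
- by move: vg; rewrite -(eq_fg z zf ug) ef !inE => /orP[]->; rewrite ?orbT.
- by move: vg; rewrite -(eq_fg y yf ug) ef !inE => /orP[]->; rewrite ?orbT.
- by have /missP/(_ g gF ug) := ax; rewrite cg.
Qed.

(** From the exit vertex [z], the edge [g] in the saturated colour [a] leads to another outside
    vertex. Only the colour of [f] may be new, and [g] keeps [a] saturated. *)
Lemma frugal_grow r c s : frugal r c s -> exits c s -> exists t, frugal r.+1 c t.
Proof.
case=> pc val size_s le_r [a [ax a_s sat_a]].
case=> f [u [v [z [fF us cu [vf vs zf z_s]]]]].
have neq_vz : v != z by apply: contraNneq z_s => <-.
have ef : ends f = [set v; z].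
  have [w _ ef] := ends_other vf; move: zf; rewrite ef !inE eq_sym (negPf neq_vz).
  by move/eqP->.
have val1 : valid c ((z, f) :: s) by split=> //; [exists v | exists u].
have el1 := elem pc val1.
have : a \notin miss c z.
  apply: contra z_s => az; rewrite (el1 z x a) ?x_verts //=.
  by rewrite mem_head.
case/missPn => g [gF zg cg]; have [w neq_wz eg] := ends_other zg.
have wg : w \in ends g by rewrite eg set22.
have w_s : w \notin verts s by apply: contra z_s; apply: sat_a wg zg.
have val2 : valid c ((w, g) :: (z, f) :: s).
  split=> //=; first by rewrite inE negb_or neq_wz.
    by exists z; rewrite ?mem_head.
  by exists x; rewrite ?cg // inE x_verts orbT.
exists ((w, g) :: (z, f) :: s); split=> //.
- by rewrite /= size_s.
- have sub : [set b in used c ((w, g) :: (z, f) :: s)] \subset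
      c f |: [set b in used c s].
    apply/subsetP => b; rewrite in_setU1 !in_set !in_cons /= cg.
    by case/or3P=> [/eqP->|->|->]; rewrite ?a_s ?orbT.
  apply: leq_trans (subset_leq_card sub) _; rewrite cardsU1 inE.
  by case: (_ \notin _) => /=; [rewrite ltnS | apply: leqW].
exists a; rewrite /used /= cg mem_head; split=> // h i j hF ch ih jh.
have eq_gh o : o \in ends g -> o \in ends h -> g = h.
  by move=> og oh; apply: pc og oh _; rewrite ?cg ?ch.
rewrite !inE => /or3P[/eqP eq_i|/eqP eq_i|is_]; try rewrite eq_i in ih.
- by move: jh; rewrite -(eq_gh w wg ih) eg !inE => /orP[]->; rewrite ?orbT.
- by move: jh; rewrite -(eq_gh z zg ih) eg !inE => /orP[]->; rewrite ?orbT.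
- by rewrite (sat_a h i j) ?orbT.
Qed.

(** At most [r] colours are used, and [x] misses at least [d.+1]. Another vertex misses at least
    [d], but not the used colour [b]. *)
Lemma unused_missing r c s v : frugal r c s -> r <= d -> v \in verts s ->
  exists2 a, a \in miss c v & a \notin used c s.
Proof.
case=> pc val _ le_r [b [bx b_s _]] le_rd vs.
suff /subsetPn[a av] : ~~ (miss c v \subset [set a in used c s]).
  by rewrite inE; exists a.
apply/negP => sub.
have [vx|neq_vx] := eqVneq v x.
  have := card_miss_ge e_notin_F d_gt0 deg_le c v; rewrite vx ends_e set21 -vx.
  move=> le1; have := leq_trans le1 (subset_leq_card sub).
  by move/leq_trans/(_ (leq_trans le_r le_rd)); rewrite addn1 ltnn.
have b_v : b \notin miss c v.
  by apply: contraNN neq_vx => bv; apply/eqP; apply: (elem pc val) bv bx; rewrite ?x_verts.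
have /(leq_trans (leq_addr _ _)) := card_miss_ge e_notin_F d_gt0 deg_le c v.
have /subset_leq_card : b |: miss c v \subset [set a in used c s].
  by rewrite subUset sub1set inE b_s.
rewrite cardsU1 b_v add1n => lt le1.
by have := leq_trans (leq_ltn_trans le1 lt) (leq_trans le_r le_rd); rewrite ltnn.
Qed.

(** * Counting edges inside the tree, and recolouring to create an exit *)

Variable Delta : nat.
Hypothesis def_k : k = Delta + d.
Hypothesis mult_le : forall u v, u != v ->
  #|[set f in e |: F | ends f == [set u; v]]| <= d.+1.

Definition boundary c s a v := exists f, [/\ f \in F, c f = a, v \in ends f,
  v \in verts s & ~~ (ends f \subset [set w in verts s])].

Lemma card_verts r c s : frugal r c s -> #|[set v in verts s]| = r.*2.+1.
Proof.
case=> _ val <- _ _; rewrite cardsE; have /card_uniqP-> := valid_uniq ends_e val.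
by elim: s {val} => //= p s ->.
Qed.

Lemma inner_degree_le r c s v : frugal r c s -> v \in verts s ->
  #|[set f in e |: F | (v \in ends f) && (ends f \subset [set w in verts s])]|
    <= r.*2 * d.+1.
Proof.
move=> fr vs; set X := [set w in verts s].
have vX : v \in X by rewrite inE.
have sub : [set f in e |: F | (v \in ends f) && (ends f \subset X)] \subset
    \bigcup_(u in X :\ v) [set f in e |: F | ends f == [set v; u]].
  apply/subsetP => f; rewrite inE => /and3P[fF vf /subsetP fX].
  have [u neq_uv ef] := ends_other vf; apply/bigcupP; exists u.
    by rewrite in_setD1 neq_uv fX // ef set22.
  by rewrite inE fF ef eqxx.
apply: leq_trans (subset_leq_card sub) _.
apply: (@leq_trans (\sum_(u in X :\ v) d.+1)).
  apply: (@leq_trans (\sum_(u in X :\ v) #|[set f in e |: F | ends f == [set v; u]]|)).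
    elim/big_rec2: _ => [|u n A _ le_n]; first by rewrite cards0.
    by apply: leq_trans (leq_card_setU _ _) _; rewrite leq_add2l.
  by apply: leq_sum => u; rewrite in_setD1 => /andP[neq_uv _]; rewrite mult_le 1?eq_sym.
rewrite sum_nat_const; have := cardsD1 v X; rewrite vX (card_verts fr) add1n.
by case=> <-.
Qed.

(** Counts pairs of a tree vertex and a colour on an inner edge there: with at most one boundary
    vertex per colour, these pairs would be more than the multiplicities allow. *)
Lemma two_boundary r c s : frugal r c s -> ~ exits c s ->
    r.*2 * d.+1 < Delta ->
  ~ (forall a u v, boundary c s a u -> boundary c s a v -> u = v).
Proof.
move=> fr noexit ltD one_bd; have [pc val size_s _ _] := fr.
set X := [set w in verts s]; have cardX := card_verts fr; rewrite -/X in cardX.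
pose inner v := [set f in F | (v \in ends f) && (ends f \subset X)].
(* At most one vertex lacks an inner edge of colour [a]: two that miss [a] are excluded by [elem],
   one that misses [a] and a boundary vertex by [noexit], two boundary vertices by [one_bd]. *)
have lower a : r.*2 <= \sum_(v in X) (a \in c @: inner v).
  have le1 : #|[set v in X | a \notin c @: inner v]| <= 1.
    have dich v : v \in [set v in X | a \notin c @: inner v] ->
        v \in verts s /\ (a \in miss c v \/ boundary c s a v).
      rewrite !inE => /andP[vs a_v]; split=> //.
      have [|/missPn[f [fF vf cf]]] := boolP (a \in miss c v); first by left.
      right; exists f; split=> //; apply: contra a_v => fX.
      by apply/imsetP; exists f; rewrite // inE fF vf.
    have mixed u v : u \in verts s -> a \in miss c u -> boundary c s a v -> False.
      move=> us au [f [fF cf vf vs /subsetPn[w wf]]]; rewrite inE => w_s.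
      by apply: noexit; exists f, u, v, w; split=> //; rewrite cf.
    apply/card_le1_eqP => u v /dich[us [au|bu]] /dich[vs [av|bv]].
    - exact: (elem pc val) vs us av au.
    - by case: (mixed u v us au bv).
    - by case: (mixed v u vs av bu).
    - exact: one_bd bv bu.
  have -> : \sum_(v in X) (a \in c @: inner v) = #|[set v in X | a \in c @: inner v]|.
    rewrite -sum1_card [RHS](eq_bigl (fun v => (v \in X) && (a \in c @: inner v))).
      by rewrite [RHS]big_mkcondr; apply: eq_bigr => v _; case: (a \in _).
    by move=> v; rewrite inE.
  have := cardsID [set v | a \in c @: inner v] X; rewrite cardX.
  have -> : X :&: [set v | a \in c @: inner v] = [set v in X | a \in c @: inner v].
    by apply/setP => v; rewrite !in_set.
  have -> : X :\: [set v | a \in c @: inner v] = [set v in X | a \notin c @: inner v].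
    by apply/setP => v; rewrite !in_set andbC.
  by move: le1; move: #|_| #|_| => n1 n2; lia.
pose innerE v := [set f in e |: F | (v \in ends f) && (ends f \subset X)].
have upper : \sum_(v in X) #|innerE v| <= r.*2.+1 * (r.*2 * d.+1).
  rewrite -cardX -sum_nat_const; apply: leq_sum => v; rewrite inE.
  exact: (inner_degree_le fr).
have sub_inner v : inner v \subset innerE v.
  by apply/subsetP => f; rewrite !inE => /and3P[-> -> ->]; rewrite orbT.
(* The uncoloured edge [e] inside the tree makes this strict. *)
have middle : (\sum_a \sum_(v in X) (a \in c @: inner v)).+1 <=
    \sum_(v in X) #|innerE v|.
  rewrite exchange_big /=.
  have xX : x \in X by rewrite inE x_verts.
  have le_v v : \sum_a (a \in c @: inner v) <= #|inner v|.
    apply: leq_trans (leq_imset_card c _); rewrite -sum1_card [X in _ <= X]big_mkcond.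
    by apply: leq_sum => a _; case: (a \in _).
  rewrite (bigD1 x) //= [X in _ <= X](bigD1 x) //= -addSn.
  apply: leq_add; last first.
    by apply: leq_sum => v _; apply: leq_trans (le_v v) (subset_leq_card (sub_inner v)).
  apply: leq_ltn_trans (le_v x) _; apply: proper_card; apply/properP; split=> //.
  exists e; last by rewrite inE (negPf e_notin_F).
  rewrite !inE eqxx ends_e set21 /=; apply/subsetP => v; rewrite !inE.
  by case/orP=> /eqP->; rewrite ?x_verts ?y_verts.
have total : r.*2 * k <= \sum_a \sum_(v in X) (a \in c @: inner v).
  rewrite mulnC -{1}(card_ord k) -sum_nat_const; exact: leq_sum.
have := leq_ltn_trans total (leq_trans middle upper).
(* As [Delta] exceeds [r.*2 * d.+1], the lower bound reaches the upper one, and strictness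
   decides. *)
have := leq_mul (leqnn r.*2) ltD; rewrite def_k; move: r.*2 => n.
by rewrite mulnDr !mulnS mulSn mulnDr; lia.
Qed.

(** A colour [al] leaves the tree at two vertices. Once it is made missing at some tree vertex [v],
    an edge of colour [al] at another vertex is an exit. *)
Lemma frugal_exits r c s : frugal r c s -> r <= d -> ~ exits c s ->
    r.*2 * d.+1 < Delta ->
  ~ (forall c', frugal r c' s -> ~ exits c' s).
Proof.
move=> fr le_rd noexit ltD no_recolor.
apply: (two_boundary fr noexit ltD) => al v1 v2 bd1 bd2.
apply/eqP; apply/negPn/negP => neq_v.
have [pc val size_s le_r [g0 [g0x g0_s sat_g0]]] := fr.
have stay f u v w : f \in F -> u \in verts s -> c f \in miss c u ->
    v \in ends f -> w \in ends f -> v \in verts s -> w \in verts s.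
  move=> fF us cu vf wf vs; apply/negPn/negP => w_s.
  by apply: noexit; exists f, u, v, w.
have al_miss u : u \in verts s -> al \notin miss c u.
  move=> us; apply/negP => alu; have [f [fF cf vf vs]] := bd1.
  case/subsetPn => w wf; rewrite inE (stay f u v1 w) // cf //.
have used_miss a : a \in used c s -> exists2 u, u \in verts s & a \in miss c u.
  case/mapP => p + ->; elim: s val {fr noexit no_recolor le_r g0_s sat_g0 bd1 bd2 stay al_miss size_s}.
    by [].
  move=> [z f] t IH /= [valt _ _ _ [u ut cu]]; rewrite inE => /orP[/eqP->|pt].
    by exists u; rewrite // inE ut orbT.
  by have [u' u't ?] := IH valt pt; exists u'; rewrite // inE u't orbT.
have al_s : al \notin used c s.
  by apply/negP => /used_miss[u us]; apply/negP/al_miss.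
have [ga gax ga_s] := unused_missing fr le_rd (x_verts s).
have neq_al a u : u \in verts s -> a \in miss c u -> al != a.
  by move=> us au; apply: contraNneq (al_miss u us) => ->.
have al_ga := neq_al ga x (x_verts s) gax.
pose W := kchain c al ga x.
have clW : kclosed F c al ga W by apply: kchain_closed.
have matched a v : v \in W -> (a == al) || (a == ga) -> a \notin miss c v ->
    exists f, [/\ f \in F, c f = a, v \in ends f & ends f \subset W].
  move=> vW a_ab /missPn[f [fF vf cf]]; exists f; split=> //.
  by apply/subsetP => w wf; apply: (clW f v w) => //; rewrite cf.
(* Otherwise [al] would match all of [W], and [ga] all of [W] but [x], against parity. *)
have [w + w_end] : exists2 w, w \in W :\ x & (al \in miss c w) || (ga \in miss c w).
  apply/exists_inP; rewrite -[X in is_true X]negbK negb_exists_in; apply/negP => /forall_inP full.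
  have xW : x \in W by apply: mem_kchain.
  have evenW : ~~ odd #|W|.
    apply: (matched_even (a := al) pc) => v vW; apply: matched => //; rewrite ?eqxx //.
    have [->|neq_vx] := eqVneq v x; first exact: al_miss (x_verts s).
    by have := full v; rewrite in_setD1 neq_vx vW negb_or => /(_ isT)/andP[].
  have : ~~ odd #|W :\ x|.
    apply: (matched_even (a := ga) pc) => v; rewrite in_setD1 => /andP[neq_vx vW].
    have gav : ga \notin miss c v.
      by have := full v; rewrite in_setD1 neq_vx vW negb_or => /(_ isT)/andP[].
    have [|f [fF cf vf fW]] := matched ga v vW _ gav; first by rewrite eqxx orbT.
    exists f; split=> //; rewrite subsetD1 fW /=; apply/negP => xf.
    by have /missP/(_ f fF xf) := gax.
  by move: evenW; rewrite (cardsD1 x W) xW add1n oddS negbK => ->.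
rewrite in_setD1 => /andP[neq_wx wW].
have w_s : w \notin verts s.
  apply/negP => ws; case/orP: w_end => [alw|gaw]; first by have := al_miss w ws; rewrite alw.
  by case/eqP: neq_wx; apply: (elem pc val) ws (x_verts s) gaw gax.
move: wW; rewrite inE => /connectP[p0 r_p0 last_p0].
case/shortenP: r_p0 last_p0 => p r_p Up _ last_p.
have [v [q [vs r_q Uq q_s]]] := path_exit (A := mem (verts s)) r_p Up (x_verts s).
rewrite -last_p => last_q; rewrite [_ v]/= in vs.
have [dl dlv dl_s] := unused_missing fr le_rd vs.
have al_dl := neq_al dl v vs dlv.
(* Exchanging [ga] and [dl] outside the tree turns the path from [v] to [w] into a chain in [al] and
   [dl]. [Y] is closed, as no edge in a missing colour leaves the tree. *)
pose Y := ~: [set u in verts s]; pose c1 := kempe c ga dl Y.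
have clY : kclosed F c ga dl Y.
  move=> f u u' fF cf uf u'f; rewrite !in_setC !in_set; apply: contraNN => u's.
  by case/orP: cf => /eqP cf; [apply: (stay f x u') | apply: (stay f v u')]; rewrite ?x_verts ?cf.
have pc1 : proper c1 by apply: kempe_proper.
have miss1 a u : u \in verts s -> (a \in miss c1 u) = (a \in miss c u).
  by move=> us; rewrite /c1 miss_kempe // in_setC in_set us.
have val1 : valid c1 s.
  by apply: valid_kempe_disjoint => // u us; rewrite in_setC in_set us.
have used1 : used c1 s = used c s.
  apply/eq_in_map => o os; have [oF sub] := valid_edge val os.
  have /card_gt0P[u uo] : 0 < #|ends o.2| by rewrite card_ends.
  by rewrite /c1 (kempeE clY oF uo) in_setC in_set sub.
have r1_q : path (bicolored F c1 al dl) v q.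
  elim: q (v) r_q q_s {Uq last_q vs dlv} => //= t q IH u /andP[r_ut r_q] /andP[t_s q_s].
  rewrite IH // andbT; have /bicoloredP[f [fF cf ef]] := r_ut.
  apply/bicoloredP; exists f; split=> //.
  have tf : t \in ends f by rewrite ef set22.
  rewrite /c1 (kempeE clY fF tf) in_setC in_set t_s.
  case/orP: cf => /eqP->; first by rewrite tpermD ?eqxx // eq_sym.
  by rewrite tpermL eqxx orbT.
have neq_vw : v != w by apply: contraNneq w_s => <-.
have w_end1 : (al \in miss c1 w) || (dl \in miss c1 w).
  rewrite /c1 !miss_kempe // in_setC in_set w_s tpermR.
  by rewrite tpermD // eq_sym.
have v_end1 : (al \in miss c1 v) || (dl \in miss c1 v) by rewrite !miss1 // dlv orbT.
(* This chain is exactly that path, so it meets the tree in [v] alone. *)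
pose Z := kchain c1 al dl v.
have memZ u : (u \in Z) = (u \in v :: q).
  have sym1 := bicolored_sym F c1 al dl.
  have deg1 u1 u2 u3 u4 := @bicolored_deg2 _ _ F c1 al dl u1 u2 u3 u4 pc1.
  rewrite inE; apply: (@pendant_path _ (bicolored F c1 al dl) sym1 deg1 v q w) => //.
  - exact: miss_pendant.
  - exact: miss_pendant.
have outZ u : u \in verts s -> u != v -> u \notin Z.
  move=> us neq_uv; rewrite memZ inE negb_or neq_uv; apply/negP => uq.
  by have /allP/(_ u uq) := q_s; rewrite /= us.
have clZ : kclosed F c1 al dl Z by apply: kchain_closed.
pose c2 := kempe c1 al dl Z.
have g0_ab a : a \notin used c s -> g0 != a by move=> a_s; apply: contraNneq a_s => <-.
have c2g0 f : (c2 f == g0) = (c f == g0) by rewrite /c2 /c1 !kempe_eq_other ?g0_ab.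
have used2 : used c2 s = used c s.
  rewrite -used1; apply/eq_in_map => o os; apply: kempe_other.
    by apply: contraNneq al_s => <-; rewrite -used1; apply: map_f.
  by apply: contraNneq dl_s => <-; rewrite -used1; apply: map_f.
have fr2 : frugal r c2 s.
  split=> //.
  - exact: kempe_proper.
  - by apply: valid_kempe_unused; rewrite ?used1.
  - by rewrite used2.
  exists g0; split.
  - by rewrite /c2 miss_kempe_other ?g0_ab // miss1 // x_verts.
  - by rewrite used2.
  - by move=> f u u' fF /eqP; rewrite c2g0 => /eqP; apply: sat_g0.
apply: (no_recolor c2 fr2).
have [u [us neq_uv bd_u]] : exists u, [/\ u \in verts s, u != v & boundary c s al u].
  have [eq_v|neq1] := eqVneq v1 v; last by exists v1; split=> //; case: bd1 => ? [].
  by exists v2; rewrite -eq_v eq_sym; split=> //; case: bd2 => ? [].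
have [f [fF cf uf _ /subsetPn[u' u'f]]] := bd_u; rewrite inE => u'_s.
have c2f : c2 f = al.
  rewrite /c2 (kempeE clZ fF uf) (negPf (outZ u us neq_uv)).
  by rewrite /c1 kempe_other cf.
exists f, v, u, u'; split=> //.
by rewrite c2f /c2 miss_kempe // mem_kchain tpermL miss1.
Qed.

(** The hypothesis restates the excluded form without [q]. It yields [r <= d], while trees,
    recoloured if necessary, grow for ever. *)
Lemma frugal_false : (forall p, Delta <= p.*2 * d.+1 -> Delta./2 <= p * d) ->
  forall r c s, ~ frugal r c s.
Proof.
move=> noform.
(* Otherwise [Delta./2 <= r * d], but the tree misses at least [r.*2.+1 * d + 2] of the [Delta + d]
   colours. *)
have small r c s : frugal r c s -> r.*2 * d.+1 < Delta.
  case=> pc val size_s _ _; rewrite ltnNge; apply/negP => /noform.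
  have := card_allmiss e_notin_F d_gt0 deg_le ends_e val (elem pc val).
  have := max_card (mem (allmiss F x y c s)); rewrite card_ord size_s => le1 le2.
  have := leq_trans le2 le1; move: def_k; clear; nia.
have le_d r c s : frugal r c s -> r <= d.
  (* [p] is the largest number with [p.*2 * d.+1 < Delta], so [r <= p]. The hypothesis for [p.+1]
     gives [p * d.+1 <= p.+1 * d], that is [p <= d]. *)
  move/small => lt_D; pose p := Delta.-1 %/ (2 * d.+1).
  have := noform p.+1; have := divn_eq Delta.-1 (2 * d.+1).
  have := ltn_pmod Delta.-1 (isT : 0 < (2 * d.+1)); rewrite -/p.
  nia.
suff down n r c s : d < r + n -> ~ frugal r c s.
  by move=> r c s; apply: (down d.+1); rewrite addnS ltnS leq_addl.
elim: n r c s => [|n IH] r c s lt_d fr.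
  by have := le_d r c s fr; rewrite addn0 in lt_d; rewrite leqNgt lt_d.
have noexit c' : frugal r c' s -> ~ exits c' s.
  move=> fr' ex; have [t frt] := frugal_grow fr' ex.
  by apply: IH frt; rewrite addSnnS.
exact: (frugal_exits fr (le_d r c s fr) (noexit c fr) (small r c s fr) noexit).
Qed.

End Growth.

(** * From extending by one edge to the chromatic index *)

(** Edges are added one by one. Existence stays doubly negated until the boolean goal
    [edge_colorable] permits classical reasoning. *)
Lemma colorable_of_extension (G : multigraph) (k : nat) : 0 < k ->
    (forall (F : {set edge G}) e (c : edge G -> 'I_k),
       e \notin F -> proper_on F c ->
       ~ forall c' : edge G -> 'I_k, ~ proper_on (e |: F) c') ->
  edge_colorable G k.
Proof.
move=> k_gt0 ext.
suff all_sets n (F : {set edge G}) : #|F| <= n ->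
    ~ forall c : edge G -> 'I_k, ~ proper_on F c.
  apply: contraT => not_col; case: (all_sets _ setT (leqnn _)) => c pc.
  case/negP: not_col; apply/existsP; exists [ffun f => c f].
  apply/forallP=> f; apply/forallP=> g; apply/implyP=> /andP[neq_fg].
  case/set0Pn=> v; rewrite inE !ffunE => /andP[vf vg].
  by apply: contraNneq neq_fg => cfg; apply/eqP; apply: pc vf vg cfg.
elim: n F => [|n IH] F leF none.
  apply: (none (fun=> Ordinal k_gt0)) => f g v fF.
  by move: leF; rewrite leqn0 cards_eq0 => /eqP F0; rewrite F0 inE in fF.
have [F0|[e eF]] := set_0Vmem F.
  by apply: (none (fun=> Ordinal k_gt0)) => f g v; rewrite F0 inE.
apply: (IH (F :\ e)) => [|c pc].
  by move: leF; rewrite (cardsD1 e) eF.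
apply: (ext (F :\ e) e c) => [||c']; rewrite ?setD11 //.
by rewrite setD1K.
Qed.

Lemma multiplicity_le_degree (G : multigraph) (u v : vertex G) :
  multiplicity u v <= degree u.
Proof.
by apply/subset_leq_card/subsetP => f; rewrite !inE => /eqP->; rewrite set21.
Qed.

Lemma edge_colorable_of_form (G : multigraph) (d : nat) :
    max_multiplicity G = d.+1 ->
    (forall p, max_degree G <= p.*2 * d.+1 -> (max_degree G)./2 <= p * d) ->
  edge_colorable G (max_degree G + d).
Proof.
move=> max_mu; set Delta := max_degree G => noform.
have deg_le (v : vertex G) : degree v <= Delta by apply: (leq_bigmax (F := @degree G)).
have mult_le (u v : vertex G) : u != v -> multiplicity u v <= d.+1.
  move=> neq_uv; rewrite -max_mu.
  exact: (leq_bigmax_cond (F := fun p => multiplicity p.1 p.2) (u, v) neq_uv).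
have Delta_gt0 : 0 < Delta.
  apply: (@leq_trans d.+1) => //; rewrite -max_mu; apply/bigmax_leqP => -[u v] _.
  exact: leq_trans (multiplicity_le_degree u v) (deg_le u).
have k_gt0 : 0 < Delta + d by rewrite addn_gt0 Delta_gt0.
case: d => [|d] in max_mu noform mult_le k_gt0 *.
  have Delta_le1 : Delta <= 1.
    by have := noform Delta; rewrite muln1 muln0 -addnn leq_addl => /(_ isT); lia.
  apply/existsP; exists [ffun=> Ordinal k_gt0].
  apply/forallP=> f; apply/forallP=> g; apply/implyP=> /andP[neq_fg].
  case/set0Pn=> v; rewrite inE => /andP[vf vg].
  have : #|[set f; g]| <= degree v.
    by apply/subset_leq_card/subsetP => h; rewrite !inE => /orP[]/eqP->.
  by rewrite cards2 neq_fg => /leq_trans/(_ (leq_trans (deg_le v) Delta_le1)).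
apply: colorable_of_extension => // F e c e_F pc F_max.
have /card_gt0P[x xe] : 0 < #|ends e| by rewrite card_ends.
have [y _ ends_e] := ends_other xe.
have le_deg (v : vertex G) : #|[set f in e |: F | v \in ends f]| + d.+1 <= Delta + d.+1.
  rewrite leq_add2r; apply: leq_trans (deg_le v).
  by apply/subset_leq_card/subsetP => f; rewrite !inE => /andP[].
have le_mult (u v : vertex G) : u != v ->
    #|[set f in e |: F | ends f == [set u; v]]| <= d.+2.
  move=> /mult_le; apply: leq_trans.
  by apply/subset_leq_card/subsetP => f; rewrite !inE => /andP[].
have [s fr] := frugal_start e_F (ltn0Sn d) le_deg F_max ends_e pc.
exact: (frugal_false e_F (ltn0Sn d) le_deg F_max ends_e erefl le_mult noform fr).
Qed.

Lemma max_multiplicity_eq0 (G : multigraph) :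
  max_multiplicity G = 0 -> max_degree G = 0.
Proof.
move=> mu0; apply/eqP; rewrite -leqn0; apply/bigmax_leqP => v _.
rewrite leqNgt; apply/negP => /card_gt0P[f]; rewrite inE => vf.
have [u neq_uv ef] := ends_other vf.
have : multiplicity v u <= max_multiplicity G.
  have neq_vu : v != u by rewrite eq_sym.
  exact: (leq_bigmax_cond (F := fun p => multiplicity p.1 p.2) (v, u) neq_vu).
rewrite mu0 leqn0 cards_eq0 => /eqP/setP/(_ f).
by rewrite !inE ef eqxx.
Qed.

Import Order.TTheory GRing.Theory Num.Theory.
Local Open Scope ring_scope.

Theorem theorem1p9 (G : multigraph) (mu : nat)
    (max_mult_G : max_multiplicity G = mu)
    (Delta_form : ~ exists p q : int,
       [/\ 0 <= q, ((q + 1) %/ 2)%Z < p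
         & (max_degree G)%:Z = 2 * p * mu%:Z - q]) :
  (chromatic_index G)%:Z <= (max_degree G)%:Z + mu%:Z - 1.
Proof.
have noform (p q : nat) : (max_degree G + q = p.*2 * mu)%N -> (p <= q.+1 %/ 2)%N.
  move=> def_q; rewrite leqNgt; apply/negP => lt_p.
  apply: Delta_form; exists p%:Z, q%:Z; split=> //; last by lia.
  by rewrite addrC -intS divz_nat ltz_nat.
case: mu => [|d] in max_mult_G noform {Delta_form} *.
  (* Without edges, [Delta = 0] has the excluded form with [p = 1] and [q = 0]. *)
  by have := noform 1 0; rewrite (max_multiplicity_eq0 max_mult_G) => /(_ erefl).
rewrite intS addrA addrAC addrK -PoszD lez_nat /chromatic_index.
case: ex_minnP => k _; apply; apply: edge_colorable_of_form => // p le_D.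
(* For this [q], the bound [p <= q.+1 %/ 2] amounts to [max_degree G <= p.*2 * d + 1]. *)
by have := noform p (p.*2 * d.+1 - max_degree G)%N (subnKC le_D); nia.
Qed.
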